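(* Let $\theta \in \mathbb{R}\setminus\mathbb{Q}$ and let $a_n = n\theta \bmod 1$ for $n = 0,1,2,\dots$ (the Kronecker sequence). Let $N \ge 1$ and let $\pi$ be the permutation of $\{0,1,\dots,N-1\}$ with $a_{\pi(0)} < a_{\pi(1)} < \dots < a_{\pi(N-1)}$. If $N \neq \pi(1) + \pi(N-1)$, then the graph obtained from the $N$-th sequence graph of $(a_n)$ by deleting the single edge $(N-1,0)$ of the cycle $C_1$ can be embedded into the torus (drawn on the torus with no edge crossings).
   Context: For a sequence $a_0,a_1,\dots$ of pairwise distinct real numbers and $N\ge 1$, let $\pi$ be the permutation of $\{0,\dots,N-1\}$ such that $a_{\pi(0)}<\dots<a_{\pi(N-1)}$. The $N$-th sequence graph of the sequence is the 4-regular graph on vertex set $\{0,1,\dots,N-1\}$ whose edges are those of two Hamiltonian cycles: the cycle $C_1$ with edges $(0,1),(1,2),\dots,(N-2,N-1),(N-1,0)$, and the cycle $C_\pi$ with edges $(\pi(0),\pi(1)),(\pi(1),\pi(2)),\dots,(\pi(N-2),\pi(N-1)),(\pi(N-1),\pi(0))$. *)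

(* Defs.v *)
From HB Require Import structures.
From mathcomp Require Import all_boot all_order all_algebra all_fingroup.
From mathcomp Require Import all_classical all_reals all_analysis.
Import Order.TTheory GRing.Theory Num.Theory.
Import numFieldNormedType.Exports.

Set Implicit Arguments.
Unset Strict Implicit.
Unset Printing Implicit Defensive.

Local Open Scope classical_set_scope.
Local Open Scope ring_scope.

(* Loops and parallel edges are allowed: the two Hamiltonian cycles of a
   sequence graph may share an edge, which then counts twice (this is what
   makes the graph 4-regular).  Edges are undirected; the order of the pair
   [ends e] only fixes a direction in which to parametrize the curve drawing
   [e] in [embeds_in]. *)
Record multigraph := Multigraph {
  vertex : finType;
  edge : finType;
  ends : edge -> vertex * vertex }.

Definition delete_edge (G : multigraph) (e0 : edge G) : multigraph :=
  @Multigraph (vertex G) {e : edge G | e != e0} (fun e => ends (val e)).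

(* A drawing without crossings on the subspace [S] of [X]: distinct points for
   the vertices, and for each edge a curve in [S] joining its ends, whose
   interior is simple, contains no vertex, and is disjoint from the interiors
   of the other edges.  The curve of a loop is a simple closed curve. *)
Definition embeds_in (R : realType) (X : topologicalType) (G : multigraph)
    (S : set X) : Prop :=
  exists (p : vertex G -> X) (c : edge G -> R -> X),
    [/\ injective p,
        (forall v, S (p v)),
        (forall e, [/\ {within `[0, 1], continuous (c e)},
                       (forall t : R, t \in `[0, 1] -> S (c e t)),
                       c e 0 = p (ends e).1
                     & c e 1 = p (ends e).2]),
        (forall e (t : R) v, t \in `]0, 1[ -> c e t <> p v)
      & (forall e e' (t t' : R), t \in `]0, 1[ -> t' \in `]0, 1[ ->
           c e t = c e' t' -> e = e' /\ t = t')].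

Definition circle (R : realType) : set (R * R)%type :=
  [set z | z.1 ^+ 2 + z.2 ^+ 2 = 1].
Arguments circle : clear implicits.

Definition torus (R : realType) : set ((R * R) * (R * R))%type :=
  circle R `*` circle R.
Arguments torus : clear implicits.

Definition embeds_in_torus (R : realType) (G : multigraph) : Prop :=
  embeds_in R G (torus R).

Definition kronecker (R : realType) (theta : R) (n : nat) : R :=
  n%:R * theta - (Num.floor (n%:R * theta))%:~R.

(* The reduction mod N only matters for N = 1, where pi(1) would otherwise be
   undefined. *)
Definition ord_mod (N : nat) (hN : (0 < N)%N) (k : nat) : 'I_N :=
  Ordinal (ltn_pmod k hN).

Definition sorts (R : realType) (a : nat -> R) (N : nat) (pi : 'S_N) : Prop :=
  forall i j : 'I_N, (i < j)%N -> a (pi i) < a (pi j).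

(* [ordS] is the cyclic successor on ['I_N].  Edge [inl i] is the edge
   (i, i+1) of C_1, and [inr i] the edge (pi(i), pi(i+1)) of C_pi, with
   indices mod N. *)
Definition sequence_graph (N : nat) (pi : 'S_N) : multigraph :=
  @Multigraph 'I_N ('I_N + 'I_N)%type
    (fun e => match e with
              | inl i => (i, ordS i)
              | inr i => (pi i, pi (ordS i))
              end).

Definition C1_edge (N : nat) (pi : 'S_N) (i : 'I_N) :
  edge (sequence_graph pi) := inl i.

(* Main.v *)
Require Import Defs.
From mathcomp Require Import all_boot all_order all_algebra all_fingroup.
From mathcomp Require Import all_classical all_reals all_analysis.
From mathcomp Require Import ring lra.
Import Order.TTheory GRing.Theory Num.Theory.
Import numFieldNormedType.Exports.

Set Implicit Arguments.
Unset Strict Implicit.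
Unset Printing Implicit Defensive.

Local Open Scope classical_set_scope.
Local Open Scope ring_scope.

(** On the torus (R/Z)^2, the orbit (s, s theta), 0 <= s <= N-1, of the linear
    flow of slope theta is a simple curve, theta being irrational.  It meets
    the meridian {0} x R/Z at the times 0, ..., N-1, in the points (0, a_n):
    these are the vertices, and the pieces of the orbit between consecutive
    times are the edges of C_1 other than (N-1,0).  The vertices cut the
    meridian into N arcs joining cyclically consecutive values of a_n: these
    are the edges of C_pi. *)

Section CirclePoint.
Variable R : realType.
Implicit Types (x y : R) (k : int).

Definition circle_pt x : R * R := (cos (pi *+ 2 * x), sin (pi *+ 2 * x)).

Lemma circle_pt_in x : circle R (circle_pt x).
Proof. exact: cos2Dsin2. Qed.

Lemma circle_ptDn x (n : nat) : circle_pt (x + n%:R) = circle_pt x.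
Proof.
rewrite /circle_pt mulrDr [pi *+ 2 * n%:R]mulr_natr.
by rewrite (periodicn (@cosD2pi R)) (periodicn (@sinD2pi R)).
Qed.

Lemma circle_ptDz x k : circle_pt (x + k%:~R) = circle_pt x.
Proof.
case: k => n; first exact: circle_ptDn.
by rewrite -[in RHS](subrK (n.+1%:R : R) x) circle_ptDn NegzE mulrNz.
Qed.

(** The subtraction formula gives [cos (2 pi (x - y)) = 1]. By the double angle formula this cosine
    is [1 - 2 sin^2 (pi (x - y))], and the sine is positive when [0 < x - y < 1]. *)
Lemma circle_pt_lt1 x y : 0 <= x - y < 1 -> circle_pt x = circle_pt y -> x = y.
Proof.
move=> /andP[xy0 xy1] [ec es]; apply/eqP; rewrite -subr_eq0.
apply: contraT => xy_neq0.
have xy_gt0 : 0 < x - y by rewrite lt_def xy_neq0.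
have pi_gt0 := pi_gt0 R.
have s_gt0 : 0 < sin (pi * (x - y)).
  by rewrite sin_gt0_pi// mulr_gt0//= gtr_pMr.
have : cos (pi *+ 2 * x - pi *+ 2 * y) = 1.
  by rewrite cosB ec es -!expr2 cos2Dsin2.
have -> : pi *+ 2 * x - pi *+ 2 * y = pi * (x - y) + pi * (x - y) by ring.
rewrite cosD -!expr2 => e; have e' := cos2Dsin2 (pi * (x - y)).
by have := exprn_gt0 2 s_gt0; lra.
Qed.

Lemma circle_pt_dist_lt1 x y :
  `|x - y| < 1 -> circle_pt x = circle_pt y -> x = y.
Proof.
rewrite ltr_norml => /andP[h1 h2] e; have [yx|xy] := leP y x.
  by apply: circle_pt_lt1 e; rewrite subr_ge0 yx.
by apply/esym; apply: circle_pt_lt1 (esym e); lra.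
Qed.

Lemma circle_pt_eq x y :
  circle_pt x = circle_pt y -> exists k, x - y = k%:~R.
Proof.
move=> e; exists (Num.floor (x - y)); apply/eqP.
rewrite subr_eq addrC -subr_eq; apply/eqP.
have /andP[h1 h2] := floor_itv (x - y).
have h2' : x - y < (Num.floor (x - y))%:~R + 1 by rewrite -[1]/(1%:~R) -intrD.
apply: circle_pt_lt1; first by apply/andP; split; lra.
by rewrite -mulrNz circle_ptDz.
Qed.

Lemma circle_pt_continuous : continuous circle_pt.
Proof.
move=> x; have lin := @mulrl_continuous R (pi *+ 2) x.
apply: (@cvg_pair _ _ _ _ (nbhs _) (nbhs _)) => /=.
- exact: continuous_comp lin (@continuous_cos R _).
- exact: continuous_comp lin (@continuous_sin R _).
Qed.

(** Projection of a straight segment in the universal cover; the choice of lifts of the endpoints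
    fixes how the curve winds. *)
Definition torus_path (u v : R * R) (t : R) : (R * R) * (R * R) :=
  (circle_pt (u.1 + t * (v.1 - u.1)), circle_pt (u.2 + t * (v.2 - u.2))).

Lemma torus_path_continuous u v : continuous (torus_path u v).
Proof.
have lin a b : continuous (fun s : R => circle_pt (a + s * b)).
  move=> t; apply: (continuous_comp (f := fun s : R => a + s * b)).
    by apply: cvgD; [exact: cvg_cst | exact: mulrr_continuous].
  exact: circle_pt_continuous.
by move=> t; apply: (@cvg_pair _ _ _ _ (nbhs _) (nbhs _)); exact: lin.
Qed.

End CirclePoint.

Lemma irrational_mulz (R : realType) (theta : R) (m k : int) :
  irrational theta -> m%:~R * theta = k%:~R -> m = 0.
Proof.
move=> irr e; apply/eqP; apply: contraT => m0; case: irr.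
exists (k%:Q / m%:Q) => //.
rewrite fmorph_div /= !ratr_int -e mulrC mulKf//.
by rewrite intr_eq0.
Qed.

(** Otherwise [(m - n) theta] would be a nonzero multiple of [theta] and an integer. The case
    [s = 0] separates the vertices, the case [s = t theta] the pieces of the orbit. *)
Lemma circle_pt_rotation_inj (R : realType) (theta s : R) (m n : nat) :
  irrational theta ->
  circle_pt (m%:R * theta + s) = circle_pt (n%:R * theta + s) -> m = n.
Proof.
move=> irr /circle_pt_eq[k]; rewrite opprD addrACA subrr addr0 -mulrBl => e.
have /eqP : (m%:Z - n%:Z)%R = 0.
  by apply: (irrational_mulz (k := k) irr); rewrite intrB.
by rewrite subr_eq0 => /eqP[].
Qed.

Section Kronecker.
Variables (R : realType) (theta : R).

Lemma kronecker_ge0 n : 0 <= kronecker theta n.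
Proof. by rewrite subr_ge0 floor_le. Qed.

Lemma kronecker_lt1 n : kronecker theta n < 1.
Proof. by rewrite ltrBlDr addrC -[1]/(1%:~R) -intrD floorD1_gt. Qed.

Lemma circle_pt_kronecker n :
  circle_pt (kronecker theta n) = circle_pt (n%:R * theta).
Proof. by rewrite /kronecker -mulrNz circle_ptDz. Qed.

Variables (N : nat) (hN : (0 < N)%N) (p : 'S_N).
Hypothesis p_sorts : sorts (kronecker theta) p.

(* The lifts to the real line, in increasing order, of the points of the
   sequence on R/Z. *)
Definition lift_pt (k : nat) : R :=
  kronecker theta (p (ord_mod hN k)) + (k %/ N)%:R.

Lemma circle_pt_lift k :
  circle_pt (lift_pt k) = circle_pt ((p (ord_mod hN k))%:R * theta).
Proof. by rewrite circle_ptDn circle_pt_kronecker. Qed.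

(** It suffices to compare neighbours. Within a block of [N] indices [p] sorts the values; at the
    next block the value drops by less than 1 while the integer part grows by 1. *)
Lemma lift_pt_lt : {mono lift_pt : j k / (j < k)%N >-> j < k}.
Proof.
apply: leW_mono; apply: le_mono; apply: homo_ltn => [|k]; first exact: lt_trans.
rewrite /lift_pt divnS// natrD.
have := kronecker_lt1 (p (ord_mod hN k)).
have := kronecker_ge0 (p (ord_mod hN k.+1)).
have [dv|ndv] := boolP (N %| k.+1)%N; first by rewrite /=; lra.
move=> _ _; rewrite add0r ltrD2r; apply: p_sorts => /=.
by rewrite modnS (negbTE ndv).
Qed.

Lemma lift_ptN k : lift_pt (k + N) = lift_pt k + 1.
Proof.
rewrite /lift_pt divnDr// divnn hN natrD addrA.
congr (kronecker _ (p _) + _ + _).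
by apply: val_inj => /=; rewrite modnDr.
Qed.

End Kronecker.

Lemma ordS_ord_mod (N : nat) (hN : (0 < N)%N) (i : 'I_N) :
  ordS i = ord_mod hN i.+1.
Proof. exact: val_inj. Qed.

Lemma ord_mod_id (N : nat) (hN : (0 < N)%N) (i : 'I_N) : ord_mod hN i = i.
Proof. by apply: val_inj; rewrite /= modn_small. Qed.

Theorem theorem1p2 (R : realType) (theta : R) (N : nat) (hN : (0 < N)%N)
    (pi : 'S_N) :
  irrational theta ->
  sorts (kronecker theta) pi ->
  N <> (pi (ord_mod hN 1) + pi (ord_mod hN N.-1))%N ->
  embeds_in_torus R (delete_edge (C1_edge pi (ord_mod hN N.-1))).
Proof.
move=> irr srt _.
pose L := lift_pt theta hN pi.
have Llt : {mono L : j k / (j < k)%N >-> j < k} := lift_pt_lt hN srt.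
have LN : L N = L 0%N + 1 by have := lift_ptN theta hN pi 0.
pose P (v : 'I_N) := (circle_pt (0 : R), circle_pt (v%:R * theta)).
(* The last arc ends at [L N = L 0 + 1], a full turn above [L 0], so that every arc runs upwards. *)
pose c (e : edge (sequence_graph pi)) : R -> (R * R) * (R * R) :=
  match e with
  | inl i => torus_path (0, i%:R * theta) (1, i.+1%:R * theta)
  | inr i => torus_path (0, L i) (0, L i.+1)
  end.
(* All arcs lift into the interval from [L 0] to [L 0 + 1], their interior points strictly inside.
   Equality on the circle will thus lift to equality of reals, even for [N = 1], where the one arc
   is the whole meridian. *)
have Lle0 j : L 0%N <= L j by rewrite leNgt Llt.
have LltN (j : 'I_N) : L j < L 0%N + 1 by rewrite -LN Llt.
have LleN (j : 'I_N) : L j.+1 <= L 0%N + 1 by rewrite -LN leNgt Llt -leqNgt.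
have arcP (i : 'I_N) (t : R) : t \in `]0, 1[ ->
    L i < L i + t * (L i.+1 - L i) < L i.+1.
  rewrite in_itv /= => /andP[t0 t1].
  have d0 : 0 < L i.+1 - L i by rewrite subr_gt0 Llt.
  have h1 : 0 < t * (L i.+1 - L i) by rewrite mulr_gt0.
  have h2 : t * (L i.+1 - L i) < L i.+1 - L i by rewrite gtr_pMl.
  by apply/andP; split; lra.
(* Between integer times the orbit is off the meridian, which holds all vertices and all arcs. *)
have flow_off (t s : R) : t \in `]0, 1[ ->
    circle_pt (0 + t * (1 - 0)) <> circle_pt (0 + s * (0 - 0)).
  rewrite in_itv /= => /andP[t0 t1] /circle_pt_dist_lt1.
  rewrite subr0 mulr1 subr0 mulr0 addr0 add0r subr0 gtr0_norm// => /(_ t1) te.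
  by rewrite te ltxx in t0.
have PL (k : nat) : P (pi (ord_mod hN k)) = (circle_pt 0, circle_pt (L k)).
  by rewrite /P -circle_pt_lift.
exists P, (fun e => c (val e)); split.
- move=> u v euv; apply: val_inj.
  apply: (circle_pt_rotation_inj (s := 0)) irr _.
  by rewrite !addr0; exact: (congr1 snd euv).
- by move=> v; split; exact: circle_pt_in.
- case=> e /= ne; split.
  + apply: continuous_subspaceT.
    by case: e {ne} => i; exact: torus_path_continuous.
  + by move=> t _; case: e {ne} => i; split; exact: circle_pt_in.
  + case: e {ne} => i /=; rewrite /torus_path /= !mul0r !addr0//.
    by rewrite -PL ord_mod_id.
  + case: e ne => i /= ne; rewrite /torus_path /= !mul1r.
      rewrite ![_ + (_ - _)]addrC !subrK.
      (* The edge leaving [N-1] is the deleted one, so [i.+1] needs no reduction mod [N] and the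
         piece does end at a vertex. *)
      have iN : (i.+1 < N)%N.
        rewrite ltn_neqAle ltn_ord andbT; apply: contra ne => /eqP iN.
        apply/eqP; congr inl; apply: val_inj.
        by rewrite /= -[in RHS]iN modn_small.
      have := circle_ptDn (0 : R) 1; rewrite add0r => ->.
      by rewrite /P /= modn_small.
    by rewrite ![_ + (_ - _)]addrC !subrK -PL -ordS_ord_mod.
- move=> [[i|i] ne] t v ht /= e.
    apply: (flow_off t 0 ht).
    by rewrite [RHS]/= mul0r addr0; exact: (congr1 fst e).
  (* The rank of [v] is [pi^-1 v]; a vertex inside the arc would have a rank strictly between [i]
     and [i.+1]. *)
  have := PL (pi^-1%g v); rewrite ord_mod_id permKV => Pv.
  have /andP[h1 h2] := arcP i t ht.
  have eL : L i + t * (L i.+1 - L i) = L (pi^-1%g v).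
    apply: circle_pt_dist_lt1; last by rewrite Pv in e; exact: (congr1 snd e).
    have := Lle0 i; have := LleN i.
    have := Lle0 (pi^-1%g v); have := LltN (pi^-1%g v).
    by rewrite ltr_norml; lra.
  by move: h1 h2; rewrite eL !Llt ltnS => h1; rewrite leqNgt h1.
- move=> [e ne] [e' ne'] t t' ht ht' /= ee'.
  suff [E ->] : e = e' /\ t = t' by split=> //; apply: val_inj.
  have e1 := congr1 fst ee'; have e2 := congr1 snd ee'.
  case: e e' {ne ne' ee'} e1 e2 => i [] i' /= e1 e2.
  (* The first coordinate gives equal times; at time [t] the two heights are those of the vertices
     [i] and [i'] rotated by [t theta]. *)
  + have tt : t = t'.
      move: e1; rewrite !subr0 !mulr1 !add0r; apply: circle_pt_dist_lt1.
      by move: ht ht'; rewrite !in_itv /= ltr_norml; lra.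
    rewrite -tt in e2 *; split=> //; congr inl; apply: val_inj => /=.
    apply: (circle_pt_rotation_inj (s := t * theta)) irr _.
    have shift j : j%:R * theta + t * theta
        = j%:R * theta + t * (j.+1%:R * theta - j%:R * theta).
      by rewrite -natr1; ring.
    by rewrite !shift.
  + by case: (flow_off t t' ht).
  + by case: (flow_off t' t ht').
  + have h := arcP i t ht; have h' := arcP i' t' ht'.
    have eL : L i + t * (L i.+1 - L i) = L i' + t' * (L i'.+1 - L i').
      apply: circle_pt_dist_lt1 e2.
      have := Lle0 i; have := LleN i; have := Lle0 i'; have := LleN i'.
      by rewrite ltr_norml; lra.
    (* The common point gives [L i < L i'.+1] and [L i' < L i.+1], hence [i <= i'] and [i' <= i]. *)
    have eii : i = i'.
      apply/val_inj/eqP; rewrite /= eqn_leq -(ltnS i) -(ltnS i') -!Llt.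
      by apply/andP; split; lra.
    rewrite -eii in eL *; split=> //.
    have d0 : L i.+1 - L i != 0 by rewrite gt_eqF// subr_gt0 Llt.
    by apply: (mulIf d0); exact: (addrI _ eL).
Qed.
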